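(* Let $G$ be a connected graph belonging to $\mathbf{W}_2$. If $A$ is an independent set of $G$ which is not a maximum independent set (that is, $|A|<\alpha(G)$), then $$|N_G(A)|\ge 2|A|.$$
   Context: All graphs are finite, undirected and simple. $V(G)$ is the vertex set, $n(G)=|V(G)|$, and $\alpha(G)$ is the maximum cardinality of an independent set of $G$. A maximum independent set is an independent set of cardinality $\alpha(G)$. The empty set is an independent set. For $A\subseteq V(G)$ the open neighborhood is $N_G(A)=\{v\in V(G)\setminus A : uv\in E(G)\text{ for some }u\in A\}$. For an integer $p\ge1$, a graph $G$ belongs to $\mathbf{W}_p$ if $n(G)\ge p$ and, for every $p$ pairwise disjoint independent sets $A_1,\ldots,A_p$ of $G$ (possibly empty), there exist $p$ pairwise disjoint maximum independent sets $S_1,\ldots,S_p$ of $G$ such that $A_i\subseteq S_i$ for every $i$. *)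

(* Defs.v *)
From mathcomp Require Import all_boot.

Set Implicit Arguments.
Unset Strict Implicit.
Unset Printing Implicit Defensive.

(* A finite simple graph is a symmetric irreflexive adjacency relation [e] on a
   finType [T] of vertices. *)

Section Graph.

Variables (T : finType) (e : rel T).
Implicit Types A S : {set T}.

Definition simple_graph : Prop := symmetric e /\ irreflexive e.

(* The null graph satisfies this vacuously; members of W_p with 0 < p have at
   least one vertex, so the convention for it is immaterial there. *)
Definition connected_graph : Prop := forall x y : T, connect e x y.

Definition independent A : bool :=
  [forall x in A, forall y in A, ~~ e x y].

Definition alpha : nat := \max_(S : {set T} | independent S) #|S|.

Definition max_independent S : bool := independent S && (#|S| == alpha).

Definition open_nbhd A : {set T} :=
  [set v | (v \notin A) && [exists u in A, e u v]].

Definition pairwise_disjoint (p : nat) (F : 'I_p -> {set T}) : Prop :=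
  forall i j : 'I_p, i != j -> [disjoint F i & F j].

(* Membership in the class W_p, meant for 0 < p. *)
Definition in_W (p : nat) : Prop :=
  p <= #|T| /\
  forall A : 'I_p -> {set T},
    (forall i, independent (A i)) -> pairwise_disjoint A ->
    exists S : 'I_p -> {set T},
      [/\ forall i, max_independent (S i),
          pairwise_disjoint S &
          forall i, A i \subset S i].

End Graph.

(* Main.v *)
Require Import Defs.
From mathcomp Require Import all_boot.
From mathcomp Require Import zify.

Set Implicit Arguments.
Unset Strict Implicit.
Unset Printing Implicit Defensive.

(** Write N[I] for the closed neighbourhood of I.  Two consequences of membership
    in W_2 carry the whole argument: G is well-covered, and after deleting N[I],
    for I independent, no vertex of what remains is isolated.  Both pass to
    G - N[I] and to unions of components ([W2_residual],
    [W2_union_of_components]).  These operations destroy connectedness, so the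
    bound is proved, by induction on |A|, under a weaker hypothesis that survives
    them: every component that meets A also meets R = G - N[A]
    ([unsaturated]).

    Suppose that A has |N(A)| < 2|A| while the bound holds for smaller sets.
    Then every neighbour q of A that has a neighbour in R is adjacent to all of A
    ([tight_boundary_complete]): otherwise A splits into two smaller parts whose
    neighbourhoods can be counted separately.

    Such a q exists because A is unsaturated.  Choose J, a maximal independent
    subset of R containing a neighbour of q, and let V = G - N[J].  In V the set A
    is maximal, and q lies in N(A) but outside V.
    - Fix a in A.  If A - a is unsaturated in V, induction gives it 2(|A| - 1)
      neighbours; a private neighbour of a in V and the vertex q are two more.
    - Otherwise A meets several components of V.  Inside some of these,
      A can be exchanged for another maximal independent set through any
      prescribed vertex p ([exchange_component]).  The new set is again a smallest
      violator, with the same q on its boundary, so q is adjacent to p, hence to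
      every vertex of V.  A maximal independent set S containing q then avoids V,
      and has size at least |A| + |J| with at most |J| elements in R; so at least
      |A| of its elements lie in N(A) outside V.  Private neighbours give |A|
      further elements of N(A) inside V. *)

Section Residuals.

Variables (T : finType) (e : rel T).
Hypotheses (e_sym : symmetric e) (e_irr : irreflexive e).
Implicit Types (U D I J A S : {set T}) (x y : T).

(** * Residual graphs and maximal independent sets *)

(** The vertex set of U - N[I], the subgraph induced on U with the closed
    neighbourhood of I deleted.  All graphs in the induction are induced subgraphs
    of one ambient graph, given by their vertex sets, so that no change of vertex
    type is ever needed. *)
Definition residual U I : {set T} :=
  [set x in U | (x \notin I) && [forall u in I, ~~ e u x]].

Definition nbhd_in U I : {set T} := U :&: open_nbhd e I.

Lemma card_disjointU (B C : {set T}) : [disjoint B & C] -> #|B :|: C| = #|B| + #|C|.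
Proof. by move=> dBC; apply/eqP; rewrite leq_card_setU. Qed.

Lemma disjoint_by (B C : {set T}) : (forall x, x \in B -> x \in C -> False) -> [disjoint B & C].
Proof. by move=> h; apply/pred0P => x /=; apply/negP => /andP[]; apply: h. Qed.

Lemma independentP I :
  reflect {in I &, forall x y, ~~ e x y} (independent e I).
Proof.
apply: (iffP forall_inP) => [h x y xI yI|h x xI].
  by have /forall_inP := h x xI; apply.
by apply/forall_inP => y; apply: h.
Qed.

Lemma residualP U I x :
  reflect [/\ x \in U, x \notin I & {in I, forall u, ~~ e u x}]
          (x \in residual U I).
Proof.
rewrite inE; apply: (iffP and3P) => [[? ? /forall_inP]|[? ? h]]; split=> //.
exact/forall_inP.
Qed.

Lemma nbhd_inP U I x :
  reflect [/\ x \in U, x \notin I & exists2 u, u \in I & e u x]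
          (x \in nbhd_in U I).
Proof.
rewrite !inE; apply: (iffP and3P) => [[? ? /exists_inP]|[? ? h]]; split=> //.
exact/exists_inP.
Qed.

Lemma residual_sub U I : residual U I \subset U.
Proof. by apply/subsetP => x /residualP[]. Qed.

Lemma residualS U I J : I \subset J -> residual U J \subset residual U I.
Proof.
move=> /subsetP sIJ; apply/subsetP => x /residualP[xU xJ h].
apply/residualP; split=> // [|u uI]; last exact/h/sIJ.
by apply: contraNN xJ; apply: sIJ.
Qed.

Lemma notin_residual U I x :
  x \in U -> x \notin residual U I -> x \in I \/ x \in nbhd_in U I.
Proof.
move=> xU; case: (boolP (x \in I)) => [|xI]; first by left.
rewrite !inE xU xI /= => /forall_inPn[u uI]; rewrite negbK => eux.
by right; apply/exists_inP; exists u.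
Qed.

(** Used to compare two sets of the same size: the one with the larger residual
    has the smaller neighbourhood. *)
Lemma card_residual U I :
  I \subset U -> #|I| + #|nbhd_in U I| + #|residual U I| = #|U|.
Proof.
move=> sIU; have dIN : [disjoint I & nbhd_in U I].
  by apply/pred0P => x /=; apply/negP => /andP[xI /nbhd_inP[_ /negP]].
have dR : [disjoint I :|: nbhd_in U I & residual U I].
  apply/pred0P => x /=; apply/negP => /andP[/setUP xIN /residualP[_ xI h]].
  case: xIN => [xI'|/nbhd_inP[_ _ [u uI eux]]]; first by rewrite xI' in xI.
  by move/negP: (h u uI).
rewrite -!card_disjointU //; apply: eq_card => x; apply/idP/idP.
  rewrite !in_setU => /orP[/orP[/(subsetP sIU)|/nbhd_inP[]]|/residualP[]] //.
move=> xU; case: (boolP (x \in residual U I)) => [xR|xR]; first by rewrite in_setU xR orbT.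
by rewrite !in_setU; case: (notin_residual xU xR) => ->; rewrite ?orbT.
Qed.

Lemma independentU I J :
  independent e I -> independent e J ->
  {in I & J, forall x y, ~~ e x y} -> independent e (I :|: J).
Proof.
move=> /independentP iI /independentP iJ h; apply/independentP => x y.
by move=> /setUP[] xIJ /setUP[] yIJ; [exact: iI|exact: h|rewrite e_sym; exact: h|exact: iJ].
Qed.

Lemma independentS I J : I \subset J -> independent e J -> independent e I.
Proof.
move=> /subsetP sIJ /independentP iJ; apply/independentP => x y xI yI.
by apply: iJ; apply: sIJ.
Qed.

Lemma independent1 x : independent e [set x].
Proof. by apply/independentP => u v /set1P-> /set1P->; rewrite e_irr. Qed.

Lemma independent_residualU U I J :
  independent e I -> J \subset residual U I -> independent e J ->
  independent e (I :|: J).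
Proof.
move=> iI /subsetP sJ iJ; apply: independentU => // x y xI /sJ /residualP[_ _].
exact.
Qed.

(** Among subsets S of U, [residual U S = set0] says for an independent S that it
    is inclusion-maximal. *)
Lemma maximal_extension U I :
  I \subset U -> independent e I ->
  exists S, [/\ I \subset S, S \subset U, independent e S & residual U S = set0].
Proof.
move=> sIU iI.
have [S /maxsetP[/andP[sSU iS] maxS] sIS] :=
  @maxset_exists _ (fun S => (S \subset U) && independent e S) I (introT andP (conj sIU iI)).
exists S; split=> //; apply/setP => x; rewrite [RHS]inE; apply/negP => xR.
have /residualP[xU xS _] := xR.
case/negP: xS; rewrite -(maxS (S :|: [set x])) ?subsetUl ?inE ?eqxx ?orbT //.
rewrite subUset sSU sub1set xU; apply: (@independent_residualU U) (independent1 x) => //.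
by rewrite sub1set.
Qed.

(** * The hereditary core of the class W_2 *)

(** The first clause is well-coveredness of U, in the form that a non-maximum
    independent set can be enlarged; the second says that no residual graph of U
    has an isolated vertex. *)
Definition W2_on U : Prop :=
  (forall I J, I \subset U -> independent e I -> J \subset U -> independent e J ->
     #|I| < #|J| -> residual U I != set0) /\
  (forall I x, I \subset U -> independent e I -> x \in residual U I ->
     exists2 y, y \in residual U I & e x y).

Lemma maximal_card U S I :
  W2_on U -> S \subset U -> independent e S -> residual U S = set0 ->
  I \subset U -> independent e I -> #|I| <= #|S|.
Proof.
move=> [wc _] sS iS rS sI iI; rewrite leqNgt; apply/negP => lt.
by have := wc _ _ sS iS sI iI lt; rewrite rS eqxx.
Qed.

Lemma residual_residual U I J :
  residual (residual U I) J = residual U (I :|: J).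
Proof.
apply/setP => x; apply/residualP/residualP.
  move=> [/residualP[xU xI hI] xJ hJ]; split; rewrite ?inE ?negb_or ?xI //.
  by move=> u /setUP[]; [apply: hI|apply: hJ].
move=> [xU]; rewrite inE negb_or => /andP[xI xJ] h; split=> //.
  by apply/residualP; split=> // u uI; apply: h; rewrite inE uI.
by move=> u uJ; apply: h; rewrite inE uJ orbT.
Qed.

(** Adding I to independent sets of U - N[I] shifts all their sizes by |I| and
    leaves their residuals unchanged. *)
Lemma W2_residual U I :
  W2_on U -> I \subset U -> independent e I -> W2_on (residual U I).
Proof.
move=> [wc ni] sI iI; set V := residual U I.
have ext J : J \subset V -> independent e J ->
    [/\ I :|: J \subset U, independent e (I :|: J) & #|I :|: J| = #|I| + #|J|].
  move=> sJ iJ; split; last 1 first.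
  - apply: card_disjointU; rewrite disjoint_sym; apply/disjoint_by => x /(subsetP sJ).
    by move=> /residualP[_ /negP].
  - by rewrite subUset sI (subset_trans sJ (residual_sub _ _)).
  - exact: independent_residualU iI sJ iJ.
split=> [J K sJ iJ sK iK lt|J x sJ iJ]; rewrite residual_residual.
  have [sIJ iIJ cJ] := ext _ sJ iJ; have [sIK iIK cK] := ext _ sK iK.
  by apply: wc sIJ iIJ sIK iIK _; rewrite cJ cK ltn_add2l.
by have [sIJ iIJ _] := ext _ sJ iJ; apply: ni.
Qed.

(** * Components *)

Definition union_of_components U D : bool :=
  (D \subset U) && [forall x in D, forall y in U, e x y ==> (y \in D)].

Lemma union_of_componentsP U D :
  reflect (D \subset U /\ forall x y, x \in D -> y \in U -> e x y -> y \in D)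
          (union_of_components U D).
Proof.
apply: (iffP andP) => -[sD h]; split=> //.
  move=> x y xD yU exy; have /forall_inP/(_ x xD)/forall_inP/(_ y yU) := h.
  by rewrite exy.
apply/forall_inP => x xD; apply/forall_inP => y yU; apply/implyP; exact: h.
Qed.

Lemma union_of_componentsD U D :
  union_of_components U D -> union_of_components U (U :\: D).
Proof.
move=> /union_of_componentsP[sD h]; apply/union_of_componentsP.
split=> [|x y /setDP[xU xD] yU exy]; first exact: subsetDl.
by rewrite inE yU andbT; apply: contraNN xD => yD; apply: h yD xU _; rewrite e_sym.
Qed.

(** If K is a maximal independent set of the other components, then D is exactly
    U - N[K]; hence this is an instance of [W2_residual]. *)
Lemma W2_union_of_components U D :
  W2_on U -> union_of_components U D -> W2_on D.
Proof.
move=> wU cD; have /union_of_componentsP[sD h] := cD.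
have [||K [_ sK iK rK]] := @maximal_extension (U :\: D) set0; rewrite ?sub0set //.
  by apply/independentP => x y; rewrite inE.
have sKU : K \subset U := subset_trans sK (subsetDl _ _).
suff -> : D = residual U K by apply: W2_residual.
apply/setP => x; apply/idP/residualP => [xD|[xU xK hx]].
  split; first exact: (subsetP sD).
    by apply/negP => /(subsetP sK); rewrite inE xD.
  move=> u uK; have /setDP[uU uD] := subsetP sK u uK.
  by apply: contraNN uD => eux; apply: h xD uU _; rewrite e_sym.
apply: contraT => xD; have : x \in residual (U :\: D) K.
  by apply/residualP; split; rewrite // inE xD.
by rewrite rK inE.
Qed.

(** For an independent A in a well-covered U: in no component of U that meets A is
    A a maximum independent set.  The formulation through unions of components
    avoids paths, and lets several components be treated at once. *)
Definition unsaturated U A : bool :=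
  [forall D : {set T}, union_of_components U D && ~~ [disjoint D & A]
     ==> ~~ [disjoint D & residual U A]].

Lemma unsaturatedP U A :
  reflect (forall D x, union_of_components U D -> x \in D -> x \in A ->
             exists2 z, z \in D & z \in residual U A)
          (unsaturated U A).
Proof.
have meet (B C : {set T}) : reflect (exists2 z, z \in B & z \in C) (~~ [disjoint B & C]).
  apply: (iffP pred0Pn) => [[z /andP[zB zC]]|[z zB zC]]; exists z => //.
  exact/andP.
apply: (iffP forallP) => [h D x cD xD xA|h D].
  have /implyP := h D; rewrite cD /= => hD; apply/meet/hD/meet; by exists x.
by apply/implyP => /andP[cD /meet[x xD xA]]; apply/meet/h; eassumption.
Qed.

(** * Private neighbours *)

(** The vertex a is in U - N[A - a], hence is not isolated there; its neighbours
    there are its private ones. *)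
Lemma private_neighbour U A a :
  W2_on U -> A \subset U -> independent e A -> a \in A ->
  exists2 y, y \in nbhd_in U A & e a y /\ {in A :\ a, forall u, ~~ e u y}.
Proof.
move=> [_ ni] sA iA aA.
have iAa : independent e (A :\ a) := independentS (subsetDl _ _) iA.
have sAa : A :\ a \subset U := subset_trans (subsetDl _ _) sA.
have aR : a \in residual U (A :\ a).
  apply/residualP; split; [exact: (subsetP sA)|by rewrite !inE eqxx|].
  by move=> u /setD1P[_ uA]; move/independentP: iA; apply.
have [y /residualP[yU yA hy] eay] := ni _ _ sAa iAa aR.
exists y => //; apply/nbhd_inP; split=> //; last by exists a.
apply/negP => yA'; move/independentP: iA => /(_ a y aA yA').
by rewrite eay.
Qed.

Lemma card_private_neighbours U A :
  W2_on U -> A \subset U -> independent e A -> #|A| <= #|nbhd_in U A|.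
Proof.
move=> wU sA iA.
pose pn a y := [&& y \in nbhd_in U A, e a y & [forall u in A :\ a, ~~ e u y]].
pose f a := odflt a [pick y | pn a y].
have fP a : a \in A -> pn a (f a).
  move=> aA; rewrite /f; case: pickP => //= none.
  have [y yN [eay hy]] := private_neighbour wU sA iA aA.
  move: (none y); rewrite /pn yN eay /=; suff -> : [forall u in A :\ a, ~~ e u y] by [].
  exact/forall_inP.
rewrite -(card_in_imset (f := f) (D := A)) => [|a b aA bA fab].
  by apply/subset_leq_card/subsetP => _ /imsetP[a /fP/and3P[fN _ _] ->].
have /and3P[_ ea _] := fP a aA; have /and3P[_ _ /forall_inP hb] := fP b bA.
apply/eqP; apply: contraT => nab; have := hb a.
by rewrite !inE nab aA -fab ea => /(_ isT).
Qed.

(** * The boundary of a smallest violator *)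

(** The induction hypothesis; U is quantified since the induction is on the size
    of A alone. *)
Definition doubling_below n : Prop := forall U A,
  #|A| < n -> W2_on U -> A \subset U -> independent e A -> unsaturated U A ->
  2 * #|A| <= #|nbhd_in U A|.

Lemma subset_unsaturated U A A' :
  A' \subset A -> unsaturated U A -> unsaturated U A'.
Proof.
move=> sA /unsaturatedP uA; apply/unsaturatedP => D x cD xD /(subsetP sA) xA.
have [z zD zR] := uA D x cD xD xA; exists z => //.
exact: (subsetP (residualS _ sA)).
Qed.

(** Suppose q misses some vertex of A.  In H = U - N[A - N(q)], let D be the
    union of the components that meet R; it contains q, because q has the
    neighbour z in R.  Let B' be the part of A in N(q) and D: it is nonempty, it is
    not all of A, and it is unsaturated in D by the choice of D.  The neighbours
    of B' in D are not neighbours of A - B', so the bounds for B' in D and for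
    A - B' in U add up to the bound for A. *)
Lemma tight_boundary_complete U A q z :
  doubling_below #|A| -> W2_on U -> A \subset U -> independent e A ->
  unsaturated U A -> #|nbhd_in U A| < 2 * #|A| ->
  q \in nbhd_in U A -> z \in residual U A -> e q z ->
  {in A, forall a, e a q}.
Proof.
move=> IH wU sA iA usA tight /nbhd_inP[qU qA [b bA ebq]] zR eqz a aA.
apply: contraT => naq; move: tight; rewrite ltnNge => /negP[].
set R := residual U A in zR.
pose B := [set u in A | e u q]; pose H := residual U (A :\: B).
have sAB : A :\: B \subset A := subsetDl _ _.
have /independentP hA := iA.
have wH : W2_on H.
  by apply: W2_residual wU (subset_trans sAB sA) (independentS sAB iA).
have sRH : R \subset H := residualS _ sAB.
(* The union of all components of H that avoid R. *)
pose M := \bigcup_(E : {set T} | union_of_components H E && [disjoint E & R]) E.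
have cM : union_of_components H M.
  apply/union_of_componentsP; split=> [|x y /bigcupP[E /andP[cE dE] xE] yH exy].
    by apply/bigcupsP => E /andP[/union_of_componentsP[]].
  apply/bigcupP; exists E; first by rewrite cE.
  by have /union_of_componentsP[_ hE] := cE; apply: hE xE yH exy.
have cD := union_of_componentsD cM; set D := H :\: M in cD.
have /union_of_componentsP[sD hD] := cD.
have qD : q \in D.
  rewrite inE; apply/andP; split; last first.
    apply/residualP; split=> // [|u]; first by rewrite inE (negPf qA) andbF.
    by rewrite !inE => /andP[nu uA]; move: nu; rewrite uA.
  apply/negP => /bigcupP[E /andP[/union_of_componentsP[_ hE] dE] qE].
  have zE := hE _ _ qE (subsetP sRH _ zR) eqz.
  by rewrite (disjointFr dE zE) in zR.
have BH u : u \in B -> u \in H.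
  rewrite inE => /andP[uA euq]; apply/residualP.
  split; [exact: (subsetP sA)|by rewrite !inE uA euq|].
  by move=> v /setDP[vA _]; apply: hA.
have bB : b \in B by rewrite inE bA.
have bD : b \in D by apply: hD qD (BH _ bB) _; rewrite e_sym.
pose B' := B :&: D.
have sB'A : B' \subset A by apply/subsetP => u /setIP[]; rewrite inE => /andP[].
have iB' := independentS sB'A iA.
have sB'D : B' \subset D := subsetIr _ _.
have usB' : unsaturated D B'.
  apply/unsaturatedP => E x /union_of_componentsP[sE hE] xE xB'.
  have cE : union_of_components H E.
    apply/union_of_componentsP; split=> [|u v uE vH euv].
      exact: subset_trans sE sD.
    exact: hE uE (hD _ _ (subsetP sE _ uE) vH euv) euv.
  have [dE|/pred0Pn[w /andP[wE wR]]] := boolP [disjoint E & R].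
    have /setDP[_ /negP[]] := subsetP sE _ xE.
    by apply/bigcupP; exists E; rewrite ?cE.
  exists w => //; have wD := subsetP sE _ wE.
  have /residualP[_ wB' hw] := subsetP (residualS U sB'A) _ wR.
  exact/residualP.
have ltB' : #|B'| < #|A|.
  apply/proper_card/properP; split=> //; exists a => //.
  by rewrite !inE (negPf naq) andbF.
have ltAB' : #|A :\: B'| < #|A|.
  apply/proper_card/properP; split; first exact: subsetDl.
  have bB' : b \in B' by apply/setIP.
  by exists b => //; rewrite in_setD bB'.
have sAB' : A :\: B' \subset A := subsetDl _ _.
have IH1 := IH D B' ltB' (W2_union_of_components wH cD) sB'D iB' usB'.
have IH2 := IH U _ ltAB' wU (subset_trans sAB' sA) (independentS sAB' iA)
  (subset_unsaturated sAB' usA).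
have cardA : #|B'| + #|A :\: B'| = #|A|.
  by rewrite -(cardsID B' A) (setIidPr sB'A).
(* A vertex of D has no neighbour in A :\: B, and all its neighbours in B lie
   in D, hence in B'. *)
have dN : [disjoint nbhd_in D B' & nbhd_in U (A :\: B')].
  apply/disjoint_by => y /nbhd_inP[yD _ _] /nbhd_inP[_ _ [u /setDP[uA uB'] euy]].
  have [uB|uB] := boolP (u \in B).
    case/negP: uB'; rewrite inE uB; apply: hD yD (BH _ uB) _.
    by rewrite e_sym.
  have /residualP[_ _ /(_ u)] := subsetP sD _ yD.
  by rewrite inE uB uA euy => /(_ isT).
rewrite -cardA mulnDr; apply: leq_trans (leq_add IH1 IH2) _.
rewrite -card_disjointU //; apply/subset_leq_card/subsetP => y.
have notinA u : u \in A -> e u y -> y \notin A.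
  by move=> uA euy; apply/negP => yA; have := hA u y uA yA; rewrite euy.
move=> /setUP[] /nbhd_inP[yU _ [u uB euy]]; apply/nbhd_inP.
  have uA := subsetP sB'A _ uB.
  split; [|exact: notinA uA euy|by exists u].
  exact: (subsetP (residual_sub _ _) _ (subsetP sD _ yU)).
have uA := subsetP sAB' _ uB.
by split; [|exact: notinA uA euy|by exists u].
Qed.

(** * Exchange of components, and the induction step *)

(** By well-coveredness of the part D, the set A may be replaced inside D by any
    maximal independent set of D, without changing its size. *)
Lemma exchange_component U J A D p :
  W2_on U -> J \subset U -> independent e J ->
  let V := residual U J in
  A \subset V -> independent e A -> residual V A = set0 ->
  union_of_components V D -> p \in D ->
  exists A', [/\ p \in A', A' \subset V, independent e A', #|A'| = #|A| &
                 A :\: D \subset A'].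
Proof.
move=> wU sJ iJ V sAV iA satA cD pD.
have wV : W2_on V by apply: W2_residual.
have wD := W2_union_of_components wV cD.
have /union_of_componentsP[sD hD] := cD.
have [||I [pI sI iI rI]] := @maximal_extension D [set p]; rewrite ?sub1set //.
  exact: independent1.
rewrite sub1set in pI.
have iAD : independent e (A :&: D) := independentS (subsetIl _ _) iA.
have rAD : residual D (A :&: D) = set0.
  apply/setP => x; rewrite [RHS]inE; apply/negP => /residualP[xD xAD hx].
  have : x \notin residual V A by rewrite satA inE.
  move/(notin_residual (subsetP sD _ xD)) => [xA|/nbhd_inP[_ _ [u uA eux]]].
    by rewrite inE xA xD in xAD.
  have uD : u \in D by apply: hD xD (subsetP sAV _ uA) _; rewrite e_sym.
  by have := hx u; rewrite inE uA uD eux => /(_ isT).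
have cI : #|I| = #|A :&: D|.
  apply/eqP; rewrite eqn_leq (maximal_card wD (subsetIr _ _)) //.
  by rewrite (maximal_card wD sI) // subsetIr.
exists (I :|: A :\: D); split.
- by rewrite inE pI.
- by rewrite subUset (subset_trans sI sD) (subset_trans (subsetDl _ _) sAV).
- apply: independentU => // [|x y xI /setDP[yA yD]].
    exact: independentS (subsetDl _ _) iA.
  apply: contraNN yD => exy.
  exact: hD (subsetP sI _ xI) (subsetP sAV _ yA) exy.
- rewrite card_disjointU ?cI ?cardsID //.
  by apply: disjoint_by => x /(subsetP sI) xD /setDP[_ /negP].
- exact: subsetUr.
Qed.

(** The heart of the proof: the two cases after the choice of J described at the
    top. *)
Lemma doubling_step U A :
  doubling_below #|A| -> W2_on U -> A \subset U -> independent e A ->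
  unsaturated U A -> 2 * #|A| <= #|nbhd_in U A|.
Proof.
move=> IH wU sA iA usA; rewrite leqNgt; apply/negP => tight.
have [A0|[a aA]] := set_0Vmem A; first by rewrite A0 cards0 in tight.
set N := nbhd_in U A in tight; set R := residual U A.
have /independentP hA := iA.
have splitU x : x \in U -> [\/ x \in A, x \in N | x \in R].
  move=> xU; have [xR|/(notin_residual xU)[]] := boolP (x \in R).
  - by apply: Or33.
  - by apply: Or31.
  - by apply: Or32.
have [q qN [z zR eqz]] : exists2 q, q \in N & exists2 z, z \in R & e q z.
  have [D0|] := boolP [forall q in N, forall z in R, ~~ e q z]; last first.
    move=> /forall_inPn[q qN /forall_inPn[z zR]]; rewrite negbK => eqz.
    by exists q => //; exists z.
  (* If no neighbour of A had one in R, then N[A] would be a union of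
     components avoiding R. *)
  have cAN : union_of_components U (U :\: R).
    apply: union_of_componentsD; apply/union_of_componentsP.
    split=> [|x y xR yU exy]; first exact: residual_sub.
    have /residualP[_ _ hx] := xR.
    case: (splitU y yU) => // [yA|yN]; first by have := hx _ yA; rewrite e_sym exy.
    by have /forall_inP/(_ _ yN)/forall_inP/(_ _ xR) := D0; rewrite e_sym exy.
  have aD : a \in U :\: R.
    rewrite inE (subsetP sA) // andbT; apply/negP => /residualP[_ /negP].
    exact.
  have /unsaturatedP/(_ _ _ cAN aD aA)[w /setDP[_ /negP wR]] := usA.
  by [].
have sRU : R \subset U := residual_sub _ _.
have [||J [zJ sJR iJ rJ]] := @maximal_extension R [set z]; rewrite ?sub1set //.
  exact: independent1.
rewrite sub1set in zJ.
have sJU := subset_trans sJR sRU.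
set V := residual U J; have sVU : V \subset U := residual_sub _ _.
have wR : W2_on R by apply: W2_residual.
have wV : W2_on V by apply: W2_residual.
have disjVR x : x \in V -> x \notin R.
  move=> /residualP[xU xJ hx]; apply/negP => xR.
  have : x \in residual R J by apply/residualP.
  by rewrite rJ inE.
have sAV : A \subset V.
  apply/subsetP => x xA; apply/residualP; split; first exact: (subsetP sA).
    by apply/negP => /(subsetP sJR) /residualP[_ /negP].
  by move=> u /(subsetP sJR)/residualP[_ _ /(_ x xA)]; rewrite e_sym.
have satV : residual V A = set0.
  apply/setP => x; rewrite [RHS]inE; apply/negP => /residualP[xV xA hx].
  have /negP[] := disjVR x xV; apply/residualP; split=> //.
  exact: (subsetP sVU).
have qV : q \notin V.
  by apply/negP => /residualP[_ _ /(_ z zJ)]; rewrite e_sym eqz.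
have sNVN : nbhd_in V A \subset N.
  by apply/subsetP => x /nbhd_inP[xV xA h]; apply/nbhd_inP; split; rewrite // (subsetP sVU).
(* When A minus a is unsaturated in V, the private neighbour y of a in V and the
   vertex q outside V supply the two elements missing from the induction. *)
have [goodV|] := boolP (unsaturated V (A :\ a)).
  have cA : #|A| = #|A :\ a|.+1 by rewrite (cardsD1 a A) aA.
  have iAa : independent e (A :\ a) := independentS (subsetDl _ _) iA.
  have sAaV := subset_trans (subsetDl A [set a]) sAV.
  have IHV : 2 * #|A :\ a| <= #|nbhd_in V (A :\ a)|.
    by apply: IH => //; rewrite cA.
  have [y yN [eay hy]] := private_neighbour wV sAV iA aA.
  have /nbhd_inP[yV yA _] := yN.
  have sub : y |: (q |: nbhd_in V (A :\ a)) \subset N.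
    rewrite !subUset !sub1set qN (subsetP sNVN) //=.
    apply/subsetP => x /nbhd_inP[xV xA [u /setD1P[_ uA] eux]].
    apply/nbhd_inP; split; [exact: (subsetP sVU)| |by exists u].
    by apply/negP => xA'; have := hA _ _ uA xA'; rewrite eux.
  have ynq : y != q by apply: contraNneq qV => <-.
  have yNa : y \notin nbhd_in V (A :\ a).
    by apply/negP => /nbhd_inP[_ _ [u /hy/negP]].
  have qNa : q \notin nbhd_in V (A :\ a).
    by apply/negP => /nbhd_inP[/(negP qV)].
  move: (subset_leq_card sub) tight IHV.
  rewrite !cardsU1 in_setU1 (negPf ynq) yNa qNa cA; clear; lia.
(* Otherwise a part D of V contains some b in A but not a, since a is in the
   residual of A minus a. *)
move=> /forallPn[D]; rewrite negb_imply negbK => /andP[/andP[cD /pred0Pn[b /andP[bD bAa]]] dD].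
have /setD1P[nba bA] : b \in A :\ a := bAa.
have aD : a \notin D.
  have aR : a \in residual V (A :\ a).
    apply/residualP; split; [exact: (subsetP sAV)|by rewrite !inE eqxx|].
    by move=> u /setD1P[_ uA]; apply: hA.
  by apply/negP => aD; rewrite (disjointFr dD aD) in aR.
have complA := @tight_boundary_complete U A _ _ IH wU sA iA usA tight.
have /union_of_componentsP[sDV hD] := cD.
(* A vertex of V with a neighbour in R would be adjacent to all of A, and so
   would connect b in D to a outside D. *)
have insul x y : x \in V -> y \in R -> ~~ e x y.
  move=> xV yR; apply/negP => exy; have xU := subsetP sVU _ xV.
  case: (splitU x xU) => [xA|xN|xR]; last by have := disjVR x xV; rewrite xR.
    by have /residualP[_ _ /(_ x xA)] := yR; rewrite exy.
  have cx := complA x y xN yR exy.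
  have xD : x \in D by apply: hD bD xV _; apply: cx.
  by case/negP: aD; apply: hD xD (subsetP sAV _ aA) _; rewrite e_sym cx.
(* The exchanged set A' keeps c, hence is still adjacent to r, and its residual
   still contains R; so A' is a violator of the same size and its boundary vertex
   r is adjacent to all of A', in particular to p. *)
have joinD D' p c r w : union_of_components V D' -> c \in A -> c \notin D' ->
    p \in D' -> r \in N -> w \in R -> e r w -> e p r.
  move=> cD' cA cD'' pD' rN wR' erw.
  have [A' [pA' sA'V iA' cardA' sAD']] :=
    exchange_component wU sJU iJ sAV iA satV cD' pD'.
  have sA'U := subset_trans sA'V sVU.
  have cA' : c \in A' by apply: (subsetP sAD'); apply/setDP.
  have sRR' : R \subset residual U A'.
    apply/subsetP => y yR; apply/residualP; split; first exact: (subsetP sRU).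
      by apply/negP => /(subsetP sA'V)/disjVR; rewrite yR.
    by move=> u /(subsetP sA'V) uV; apply: insul.
  have usA' : unsaturated U A'.
    apply/unsaturatedP => E x cE xE xA'.
    have /union_of_componentsP[sE hE] := cE.
    have [u uE uA] : exists2 u, u \in E & u \in A.
      have xV := subsetP sA'V _ xA'.
      case: (splitU x (subsetP sE _ xE)) => [xA|xN|xR].
      - by exists x.
      - have /nbhd_inP[_ _ [u uA eux]] := xN; exists u => //.
        by apply: hE xE (subsetP sA _ uA) _; rewrite e_sym.
      - by have := disjVR x xV; rewrite xR.
    have /unsaturatedP/(_ _ _ cE uE uA)[y yE yR] := usA.
    by exists y => //; apply: (subsetP sRR').
  have tight' : #|nbhd_in U A'| < 2 * #|A'|.
    rewrite cardA'; apply: leq_ltn_trans tight.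
    move: (card_residual sA) (card_residual sA'U) (subset_leq_card sRR').
    rewrite -/N -/R cardA'; clear; lia.
  rewrite -cardA' in IH.
  have rV : r \notin V by apply: contraTN erw => rV; apply: insul.
  have rN' : r \in nbhd_in U A'.
    have /nbhd_inP[rU _ _] := rN; apply/nbhd_inP; split=> //.
      by apply: contraNN rV; apply: (subsetP sA'V).
    by exists c => //; apply: complA rN wR' erw _ cA.
  exact: (tight_boundary_complete IH wU sA'U iA' usA' tight' rN' (subsetP sRR' _ wR') erw pA').
(* D and its complement in V both miss a vertex of A, so both kinds of p are
   covered. *)
have qjoin p : p \in V -> e p q.
  move=> pV; have [pD|pD] := boolP (p \in D).
    exact: joinD cD aA aD pD qN zR eqz.
  have bD' : b \notin V :\: D by apply/negP => /setDP[_ /negP].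
  have pD' : p \in V :\: D by apply/setDP.
  exact: joinD (union_of_componentsD cD) bA bD' pD' qN zR eqz.
have qU : q \in U by have /nbhd_inP[] := qN.
have [||S [qS sSU iS rS]] := @maximal_extension U [set q]; rewrite ?sub1set //.
  exact: independent1.
rewrite sub1set in qS; have /independentP hS := iS.
have disjSV x : x \in S -> x \notin V.
  by move=> xS; apply/negP => /qjoin exq; have := hS _ _ xS qS; rewrite exq.
have sSNR : S :\: R \subset N.
  apply/subsetP => x /setDP[xS xR]; have := disjSV x xS.
  case: (splitU x (subsetP sSU _ xS)) => // [xA|xR']; first by rewrite (subsetP sAV).
  by rewrite xR' in xR.
(* J is a maximal, hence maximum, independent set of R, and A together with J is
   an independent set of U; S is a maximum one. *)
have cSR : #|S :&: R| <= #|J|.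
  by apply: (maximal_card wR) => //; [exact: subsetIr|exact: independentS (subsetIl _ _) iS].
have cAJ : #|A| + #|J| <= #|S|.
  rewrite -card_disjointU; last first.
    by apply: disjoint_by => x xA /(subsetP sJR)/residualP[_ /negP].
  apply: (maximal_card wU) => //; first by rewrite subUset sA.
  exact: independent_residualU iA sJR iJ.
have dSP : [disjoint S :\: R & nbhd_in V A].
  by apply: disjoint_by => x /setDP[/disjSV/negP xV _] /nbhd_inP[].
have cP := card_private_neighbours wV sAV iA.
have cN : #|S :\: R| + #|nbhd_in V A| <= #|N|.
  by rewrite -card_disjointU // subset_leq_card // subUset sSNR.
move: tight (cardsID R S) cSR cAJ cP cN; clear; lia.
Qed.

Lemma doubling U A :
  W2_on U -> A \subset U -> independent e A -> unsaturated U A ->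
  2 * #|A| <= #|nbhd_in U A|.
Proof.
have [n] := ubnP #|A|; elim: n U A => // n IH U A; rewrite ltnS => leAn.
apply: doubling_step => U' A' lt; apply: IH.
exact: leq_trans lt leAn.
Qed.

(** * From the class W_2 to residual graphs *)

Lemma independent_card_alpha I : independent e I -> #|I| <= alpha e.
Proof. by move=> iI; apply: (leq_bigmax_cond (F := fun S : {set T} => #|S|)). Qed.

Lemma in_W2_extension I J :
  in_W e 2 -> independent e I -> independent e J -> [disjoint I & J] ->
  exists S S', [/\ max_independent e S, max_independent e S',
    [disjoint S & S'], I \subset S & J \subset S'].
Proof.
move=> [_ W] iI iJ dIJ.
have i0 : 0 < 2 by []. have i1 : 1 < 2 by [].
have [||S [mS dS sS]] := W (fun i : 'I_2 => if val i == 0 then I else J).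
- by move=> i; case: ifP.
- case=> [[|[|//]] lti] [[|[|//]] ltj] //= _; by rewrite disjoint_sym.
exists (S (Ordinal i0)), (S (Ordinal i1)); split=> //; first exact: dS.
  exact: (sS (Ordinal i0)).
exact: (sS (Ordinal i1)).
Qed.

Lemma residual_setT_neq0 I :
  in_W e 2 -> independent e I -> #|I| < alpha e -> residual setT I != set0.
Proof.
move=> W iI lt; have i0 : independent e set0 by apply/independentP => x y; rewrite inE.
have [|S [_ [/andP[iS /eqP cS] _ _ sIS _]]] := in_W2_extension W iI i0.
  by apply: disjoint_by => x _; rewrite inE.
have /properP[_ [x xS xI]] : I \proper S by rewrite properEcard sIS cS.
apply/set0Pn; exists x; apply/residualP; split=> // u uI.
by move/independentP: iS; apply=> //; apply: (subsetP sIS).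
Qed.

(** For the absence of isolated vertices, extend I and the vertex x to disjoint
    maximum independent sets S and S'.  As x is not in S and S is maximum, x has a
    neighbour in S, and it survives the deletion of N[I] because S contains I. *)
Lemma in_W2_W2_on : in_W e 2 -> W2_on setT.
Proof.
move=> W; split=> [I J _ iI _ iJ lt|I x _ iI /residualP[_ xI hx]].
  exact: residual_setT_neq0 W iI (leq_trans lt (independent_card_alpha iJ)).
have [|S [S' [/andP[iS /eqP cS] _ dSS' sIS]]] := in_W2_extension W iI (independent1 x).
  by apply: disjoint_by => y yI /set1P yx; rewrite -yx yI in xI.
rewrite sub1set => xS'; have xS : x \notin S by rewrite (disjointFl dSS').
have : ~~ independent e (x |: S).
  apply/negP => /independent_card_alpha; rewrite cardsU1 xS cS.
  by rewrite add1n ltnn.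
have /independentP hS := iS.
have [/exists_inP[y yS exy] _|none] := boolP [exists y in S, e x y].
  exists y => //; apply/residualP; split=> //.
    by apply/negP => yI; have := hx _ yI; rewrite e_sym exy.
  by move=> u /(subsetP sIS) uS; apply: hS.
case/negP; apply: independentU (independent1 x) iS _ => u y /set1P-> yS.
by apply: contraNN none => exy; apply/exists_inP; exists y.
Qed.

Lemma connected_unsaturated A :
  connected_graph e -> residual setT A != set0 -> unsaturated setT A.
Proof.
move=> con /set0Pn[z zR]; apply/unsaturatedP => D x cD xD _.
have /union_of_componentsP[_ hD] := cD.
exists z => //; have /connectP[p] := con x z; elim: p x xD {zR cD} => [|y p IH] x xD /=.
  by move=> _ ->.
by move=> /andP[exy]; apply: IH; apply: hD xD _ exy; rewrite inE.
Qed.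

End Residuals.

Theorem theorem4p1 (T : finType) (e : rel T) (A : {set T}) :
  simple_graph e -> connected_graph e -> in_W e 2 ->
  independent e A -> #|A| < alpha e ->
  2 * #|A| <= #|open_nbhd e A|.
Proof.
move=> [e_sym e_irr] con W iA lt.
rewrite -[open_nbhd e A]setTI.
apply: (doubling e_sym e_irr (in_W2_W2_on e_sym e_irr W) (subsetT _) iA).
exact: connected_unsaturated con (residual_setT_neq0 W iA lt).
Qed.
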